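(* The set of nodal radial basis functions $\{\Psi_{\alpha,x_j}\}_{x_j\in U}$ forms an orthonormal basis of the space $\overline{U}$ of interpolants on $U$, for the inner product of interpolated functions defined by $$\langle\overline{f},\overline{g}\rangle=\sum_{k=1}^n\left|\overline{f}(x_k)\,\overline{g}(x_k)\right|$$ for any two interpolants $\overline{f},\overline{g}\in\overline{U}$.
   Context: $U=\{x_1,\dots,x_n\}\subset\mathbb{R}^d$ is a finite set of pairwise distinct nodes, $\|\cdot\|_d$ is the Euclidean norm on $\mathbb{R}^d$, $\alpha>0$ is a width parameter, and $\Phi_\alpha(x)=\phi(\|x\|_d/\alpha)$ is a radial basis function such that the matrix $[\Phi_\alpha]=(\Phi_\alpha(x_i-x_j))_{1\le i,j\le n}$ is invertible. The interpolant on $U$ of a function $f$ is $\overline{f}(x)=\sum_{j=1}^n\omega_j\Phi_\alpha(x-x_j)$, with weights $\omega_j$ determined by $\overline f(x_i)=f(x_i)$ for all $x_i\in U$; $\overline{U}$ is the space of such interpolants. The nodal radial basis functions on $U$ are $$\Psi_{\alpha,x_j}(x)=\sum_{i=1}^n\Omega_{ij}\,\Phi_\alpha(x_i-x),\qquad 1\le j\le n,$$ where $\Omega_{ij}$ are the entries of $[\Phi_\alpha]^{-1}$; they satisfy $\Psi_{\alpha,x_j}(x_i)=1$ if $i=j$ and $0$ if $i\ne j$. The pairing $\langle\cdot,\cdot\rangle$, with the absolute values, is what is called the inner product here. *)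

(* Defs.v *)
From HB Require Import structures.
From mathcomp Require Import all_boot all_order all_algebra.
From mathcomp Require Import boolp classical_sets functions reals.

Set Implicit Arguments.
Unset Strict Implicit.
Unset Printing Implicit Defensive.

Import Order.TTheory GRing.Theory Num.Theory.

Local Open Scope classical_set_scope.
Local Open Scope ring_scope.

(* The library's own norm on 'rV[R]_d is the sup norm. *)
Definition euclid_norm (R : realType) (d : nat) (x : 'rV[R]_d) : R :=
  Num.sqrt (\sum_(k < d) x ord0 k ^+ 2).

Definition rbf (R : realType) (d : nat) (phi : R -> R) (alpha : R)
    (x : 'rV[R]_d) : R :=
  phi (euclid_norm x / alpha).

Definition rbf_matrix (R : realType) (d n : nat) (phi : R -> R) (alpha : R)
    (x : 'I_n -> 'rV[R]_d) : 'M[R]_n :=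
  \matrix_(i, j) rbf phi alpha (x i - x j).

Definition is_interpolant (R : realType) (d n : nat) (phi : R -> R) (alpha : R)
    (x : 'I_n -> 'rV[R]_d) (f fbar : 'rV[R]_d -> R) : Prop :=
  exists omega : 'I_n -> R,
    (forall y, fbar y = \sum_(j < n) omega j * rbf phi alpha (y - x j)) /\
    (forall i, fbar (x i) = f (x i)).

(* The codomain is R^o so that the functions form an R-module. *)
Definition interpolants (R : realType) (d n : nat) (phi : R -> R) (alpha : R)
    (x : 'I_n -> 'rV[R]_d) : set ('rV[R]_d -> R^o) :=
  [set fbar | exists f : 'rV[R]_d -> R, is_interpolant phi alpha x f fbar].

Definition nodal_rbf (R : realType) (d n : nat) (phi : R -> R) (alpha : R)
    (x : 'I_n -> 'rV[R]_d) (j : 'I_n) : 'rV[R]_d -> R^o :=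
  fun y => \sum_(i < n)
    invmx (rbf_matrix phi alpha x) i j * rbf phi alpha (x i - y).

(* Because of the absolute values this pairing is not bilinear. *)
Definition interp_pairing (R : realType) (d n : nat) (x : 'I_n -> 'rV[R]_d)
    (f g : 'rV[R]_d -> R) : R :=
  \sum_(k < n) `|f (x k) * g (x k)|.

(* MathComp's [free] and [basis_of] require a finite-dimensional ambient
   space, which the space of all functions on R^d is not. *)
Definition lin_indep (R : realType) (E : lmodType R) (n : nat)
    (b : 'I_n -> E) : Prop :=
  forall c : 'I_n -> R, \sum_(j < n) c j *: b j = 0 -> forall j, c j = 0.

Definition spans (R : realType) (E : lmodType R) (n : nat)
    (V : set E) (b : 'I_n -> E) : Prop :=
  forall v, V v -> exists c : 'I_n -> R, v = \sum_(j < n) c j *: b j.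

Definition is_basis_of (R : realType) (E : lmodType R) (n : nat)
    (V : set E) (b : 'I_n -> E) : Prop :=
  [/\ GRing.submod_closed (mem V), forall j, V (b j), lin_indep b & spans V b].

Definition orthonormal_for (R : realType) (E : Type) (n : nat)
    (p : E -> E -> R) (b : 'I_n -> E) : Prop :=
  forall i j, p (b i) (b j) = (i == j)%:R.

(* Main.v *)
(* As phi is applied to a norm, the matrix A = (Phi (x_i - x_j)) is symmetric.
   Hence the values of the nodal functions at the nodes form A^T A^-1 = 1, which
   gives independence and orthonormality, and an interpolant with weights w is
   the combination of the nodal functions with coefficients A w. *)

Require Import Defs.
From mathcomp Require Import all_boot all_order all_algebra.
From mathcomp Require Import boolp classical_sets functions reals.
Import Order.TTheory GRing.Theory Num.Theory.
Local Open Scope ring_scope.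

Lemma euclid_normN (R : realType) (d : nat) (v : 'rV[R]_d) :
  euclid_norm (- v) = euclid_norm v.
Proof. by congr Num.sqrt; apply: eq_bigr => k _; rewrite mxE sqrrN. Qed.

Lemma rbf_distC (R : realType) (d : nat) (phi : R -> R) (alpha : R)
    (u v : 'rV[R]_d) : rbf phi alpha (u - v) = rbf phi alpha (v - u).
Proof. by rewrite /rbf -(opprB v u) euclid_normN. Qed.

Lemma lincomb_fctE (R : realType) (T : Type) (n : nat) (c : 'I_n -> R)
    (b : 'I_n -> T -> R^o) (y : T) :
  (\sum_(j < n) c j *: b j) y = \sum_(j < n) c j * b j y.
Proof. by rewrite fct_sumE. Qed.

(** A combination of translates interpolates itself, so [v] serves as its own interpolated
    function. *)
Lemma interpolantsP (R : realType) (d n : nat) (phi : R -> R) (alpha : R)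
    (x : 'I_n -> 'rV[R]_d) (v : 'rV[R]_d -> R^o) :
  interpolants phi alpha x v <->
  exists w : 'I_n -> R,
    forall y, v y = \sum_(j < n) w j * rbf phi alpha (y - x j).
Proof.
split=> [[f [w [vE _]]] | [w vE]]; first by exists w.
by exists v, w.
Qed.

Lemma nodal_rbf_interpolant (R : realType) (d n : nat) (phi : R -> R)
    (alpha : R) (x : 'I_n -> 'rV[R]_d) (j : 'I_n) :
  interpolants phi alpha x (nodal_rbf phi alpha x j).
Proof.
(* The weights are column [j] of the inverse matrix. *)
apply/interpolantsP; exists (fun i => invmx (rbf_matrix phi alpha x) i j) => y.
by apply: eq_bigr => i _; rewrite rbf_distC.
Qed.

Lemma interpolants_submod_closed (R : realType) (d n : nat) (phi : R -> R)
    (alpha : R) (x : 'I_n -> 'rV[R]_d) :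
  GRing.submod_closed (mem (interpolants phi alpha x)).
Proof.
split=> [|a u v].
  apply/mem_set/interpolantsP; exists (fun=> 0) => y.
  by rewrite big1 // => j _; rewrite mul0r.
move=> /set_mem/interpolantsP[wu uE] /set_mem/interpolantsP[wv vE].
apply/mem_set/interpolantsP; exists (fun j => a * wu j + wv j) => y.
(* The pointwise module operations on functions into [R^o] unfold to this by computation. *)
transitivity (a * u y + v y) => //.
rewrite uE vE mulr_sumr -big_split /=.
by apply: eq_bigr => j _; rewrite mulrDl mulrA.
Qed.

Lemma nodal_rbf_node (R : realType) (d n : nat) (phi : R -> R) (alpha : R)
    (x : 'I_n -> 'rV[R]_d) (j k : 'I_n) :
  rbf_matrix phi alpha x \in unitmx ->
  nodal_rbf phi alpha x j (x k) = (k == j)%:R.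
Proof.
(* With A the matrix, this is entry [(k, j)] of A A^-1 = 1; symmetry of the kernel matches it with
   the value at [x k]. *)
move=> /mulmxV/matrixP/(_ k j); rewrite !mxE => <-.
by apply: eq_bigr => i _; rewrite mxE rbf_distC mulrC.
Qed.

Lemma nodal_rbf_lin_indep (R : realType) (d n : nat) (phi : R -> R) (alpha : R)
    (x : 'I_n -> 'rV[R]_d) :
  rbf_matrix phi alpha x \in unitmx -> lin_indep (nodal_rbf phi alpha x).
Proof.
move=> Aunit c c0 k.
(* Evaluation at the node [x k] isolates the coefficient [c k]. *)
have := congr1 (fun f => f (x k)) c0.
rewrite lincomb_fctE (bigD1 k) //= big1 => [|j jk].
  by rewrite nodal_rbf_node // eqxx mulr1 addr0.
by rewrite nodal_rbf_node // eq_sym (negPf jk) mulr0.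
Qed.

Lemma nodal_rbf_spans (R : realType) (d n : nat) (phi : R -> R) (alpha : R)
    (x : 'I_n -> 'rV[R]_d) :
  rbf_matrix phi alpha x \in unitmx ->
  spans (interpolants phi alpha x) (nodal_rbf phi alpha x).
Proof.
move=> Aunit v /interpolantsP[w vE].
pose A := rbf_matrix phi alpha x; pose W : 'cV_n := \col_i w i.
(* Entry [j] of [A *m W] is the nodal value [v (x j)]. *)
exists (fun j => (A *m W) j ord0); apply/funext => y.
rewrite lincomb_fctE vE.
under [RHS]eq_bigr do rewrite mulr_sumr.
rewrite exchange_big /=; apply: eq_bigr => i _.
(* After the exchange of sums, the coefficient of the translate at [x i] is entry [i] of A^-1 (A W),
   that is, [w i]. *)
have <- : (invmx A *m (A *m W)) i ord0 = w i by rewrite mulKmx // mxE.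
rewrite mxE mulr_suml; apply: eq_bigr => j _.
by rewrite rbf_distC mulrCA mulrA.
Qed.

Lemma nodal_rbf_orthonormal (R : realType) (d n : nat) (phi : R -> R)
    (alpha : R) (x : 'I_n -> 'rV[R]_d) :
  rbf_matrix phi alpha x \in unitmx ->
  orthonormal_for (interp_pairing x) (nodal_rbf phi alpha x).
Proof.
(* The [i]-th nodal function vanishes at every node but [x i]. The one remaining term is the
   absolute value of 0 or 1, hence unchanged by it. *)
move=> Aunit i j; rewrite /interp_pairing (bigD1 i) //= big1 => [|k ki].
  by rewrite !nodal_rbf_node // eqxx mul1r normr_nat addr0.
by rewrite nodal_rbf_node // (negPf ki) mul0r normr0.
Qed.

Theorem theorem2 (R : realType) (d n : nat) (phi : R -> R) (alpha : R)
    (x : 'I_n -> 'rV[R]_d)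
    (halpha : 0 < alpha)
    (hx : injective x)
    (hPhi : rbf_matrix phi alpha x \in unitmx) :
  is_basis_of (interpolants phi alpha x) (nodal_rbf phi alpha x) /\
  orthonormal_for (interp_pairing x) (nodal_rbf phi alpha x).
Proof.
split; last exact: nodal_rbf_orthonormal.
split.
- exact: interpolants_submod_closed.
- exact: nodal_rbf_interpolant.
- exact: nodal_rbf_lin_indep.
- exact: nodal_rbf_spans.
Qed.
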